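(* Let $S=\mathbb{K}[x_1,\dots,x_n]$ be a polynomial ring over a field $\mathbb{K}$ and let $I\subset S$ be a monomial ideal. If $I$ has linear quotients with respect to some support-degree increasing admissible order, then $I$ is componentwise support-linear.
   Context: $G(I)$ denotes the set of minimal monomial generators of a monomial ideal $I$. $I$ has linear quotients if there is an order $u_1,\dots,u_m$ of $G(I)$ such that for each $i=2,\dots,m$ the colon ideal $\langle u_1,\dots,u_{i-1}\rangle:u_i$ is generated by a subset of the variables; any such order is called an admissible order. (Principal monomial ideals trivially have linear quotients.) For a vector $\mathbf{a}\in\mathbb{Z}^n$, $\operatorname{supp}(\mathbf{a})=\{i:\mathbf{a}(i)\neq 0\}$; for a $\mathbb{Z}^n$-homogeneous element $m$ of degree $\mathbf{a}$ in a $\mathbb{Z}^n$-graded module, $\operatorname{supp}(m)=\operatorname{supp}(\mathbf{a})$ and the support-degree of $m$ is $\operatorname{supp.deg}(m)=|\operatorname{supp}(\mathbf{a})|$. An admissible order is support-degree increasing if $\operatorname{supp.deg}(u_1)\le\operatorname{supp.deg}(u_2)\le\cdots\le\operatorname{supp.deg}(u_m)$. Let $M$ be a finitely generated $\mathbb{N}^n$-graded $S$-module. For $d\in\{0,1,\dots,n\}$, $M_{\langle d\rangle}$ is the submodule of $M$ generated by all homogeneous elements of support-degree exactly $d$. The support-regularity of $M$ is $\operatorname{supp.reg}(M)=\max\{|\operatorname{supp}(\mathbf{b})|-i:\beta_{i,\mathbf{b}}(M)\ne 0\}$, where $\beta_{i,\mathbf{b}}(M)=\dim_{\mathbb{K}}\operatorname{Tor}_i^S(M,\mathbb{K})_{\mathbf{b}}$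 are the $\mathbb{N}^n$-graded Betti numbers. $M$ is $d$-support-linear if $M=M_{\langle d\rangle}$ and $\operatorname{supp.reg}(M)=d$; the zero module is regarded as $d$-support-linear for every $d$. $M$ is componentwise support-linear if $M_{\langle d\rangle}$ is $d$-support-linear for all $d$. *)

(* Defs.v *)
From mathcomp Require Import all_boot all_order all_algebra.
From mathcomp Require Export mpoly.

Set Implicit Arguments.
Unset Strict Implicit.
Unset Printing Implicit Defensive.

Import GRing.Theory.
Local Open Scope ring_scope.

Definition supp n (a : 'X_{1..n}) : {set 'I_n} := [set i | a i != 0%N].

Definition suppdeg n (a : 'X_{1..n}) : nat := #|supp a|.

(* N^n-gradings of a module over S = K[x_1, ..., x_n]; [gcomp g a x] reads
   "x is homogeneous of degree a", so 0 is homogeneous of every degree. The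
   last two fields say that M is the direct sum of its homogeneous components. *)
Record ngrading (K : fieldType) (n : nat) (M : lmodType {mpoly K[n]}) :=
  NGrading {
    gcomp : 'X_{1..n} -> M -> Prop;
    gcomp0 : forall a, gcomp a 0;
    gcompD : forall a x y, gcomp a x -> gcomp a y -> gcomp a (x + y);
    gcompX : forall a b (c : K) x,
      gcomp a x -> gcomp (b + a)%MM ((c *: 'X_[b] : {mpoly K[n]}) *: x);
    gcomp_sum : forall x, exists (s : seq 'X_{1..n}) (f : 'X_{1..n} -> M),
      (forall a, gcomp a (f a)) /\ x = \sum_(a <- s) f a;
    gcomp_direct : forall (s : seq 'X_{1..n}) (f : 'X_{1..n} -> M),
      uniq s -> (forall a, gcomp a (f a)) -> \sum_(a <- s) f a = 0 ->
      forall a, a \in s -> f a = 0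
  }.

Section PolynomialRing.
Variables (K : fieldType) (n : nat).
Local Notation S := {mpoly K[n]}.

Definition scomp (a : 'X_{1..n}) (f : S) : Prop := exists c : K, f = c *: 'X_[a].

Lemma scomp0 a : scomp a 0.
Proof. by exists 0; rewrite scale0r. Qed.

Lemma scompD a f g : scomp a f -> scomp a g -> scomp a (f + g).
Proof. by move=> [c ->] [d ->]; exists (c + d); rewrite scalerDl. Qed.

Lemma scompX a b (c : K) (f : S^o) :
  scomp a f -> scomp (b + a)%MM ((c *: 'X_[b] : S) *: f).
Proof.
move=> [d ->]; exists (c * d).
by rewrite /GRing.scale /= -scalerAl -scalerAr scalerA mpolyXD.
Qed.

Lemma scomp_sum (f : S^o) : exists (s : seq 'X_{1..n}) (h : 'X_{1..n} -> S^o),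
  (forall a, scomp a (h a)) /\ f = \sum_(a <- s) h a.
Proof.
exists (msupp f), (fun a => f@_a *: 'X_[a] : S); split; last exact: mpolyE.
by move=> a; exists f@_a.
Qed.

Lemma scomp_direct (s : seq 'X_{1..n}) (h : 'X_{1..n} -> S^o) :
  uniq s -> (forall a, scomp a (h a)) -> \sum_(a <- s) h a = 0 ->
  forall a, a \in s -> h a = 0.
Proof.
move=> us hh h0 a sa; have /(congr1 (mcoeff a)) := h0.
rewrite (bigD1_seq a) //= raddfD /= raddf_sum /= mcoeff0 big1 ?addr0 => [|b /negPf ba].
  by have [c ->] := hh a; rewrite mcoeffZ mcoeffX eqxx mulr1 => ->; rewrite scale0r.
by have [c ->] := hh b; rewrite mcoeffZ mcoeffX ba mulr0.
Qed.

(* S as a graded module over itself. *)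
Definition sgrading : @ngrading K n S^o :=
  @NGrading K n S^o scomp scomp0 scompD scompX scomp_sum scomp_direct.

End PolynomialRing.

(* Graded modules are presented as submodules N : M -> Prop of an ambient graded
   module M (any graded module is such, with N everything). *)
Section GradedModules.
Variables (K : fieldType) (n : nat).
Local Notation S := {mpoly K[n]}.

Definition submod_gen (M : lmodType S) (G : M -> Prop) (x : M) : Prop :=
  exists (r : nat) (c : 'I_r -> S) (g : 'I_r -> M),
    (forall j, G (g j)) /\ x = \sum_j c j *: g j.

Variables (M : lmodType S) (gM : ngrading M).

(* A graded free resolution ... -> F_1 -> F_0 -> N -> 0 with
   F_i = S(-frshift i 0) + ... + S(-frshift i (frrank i - 1)), elements of F_i
   being row vectors and F_{i+1} -> F_i being v |-> v *m frdiff i.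
   As the q-th basis vector of F_i has degree frshift i q, the differential is
   homogeneous iff frdiff i p q * x^(frshift i q) is homogeneous of degree
   frshift i.+1 p for all p and q. *)
Record graded_free_resolution (N : M -> Prop) := GradedFreeResolution {
  frrank : nat -> nat;
  frshift : forall i, 'I_(frrank i) -> 'X_{1..n};
  frdiff : forall i, 'M[S]_(frrank i.+1, frrank i);
  fraug : 'I_(frrank 0) -> M;
  frdiff_homog : forall i p q,
    scomp (frshift p) (frdiff i p q * 'X_[frshift q]);
  fraug_homog : forall q, gcomp gM (frshift q) (fraug q);
  fr_onto : forall x,
    N x <-> exists v : 'rV[S]_(frrank 0), x = \sum_q v 0 q *: fraug q;
  fr_exact0 : forall v : 'rV[S]_(frrank 0),
    \sum_q v 0 q *: fraug q = 0 <-> exists w, v = w *m frdiff 0;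
  fr_exactS : forall i (v : 'rV[S]_(frrank i.+1)),
    v *m frdiff i = 0 <-> exists w, v = w *m frdiff i.+1
}.

Section Tor.
Variables (N : M -> Prop) (F : graded_free_resolution N).

(* F (x)_S K, where K = S / (x_1, ..., x_n): F_i (x) K = K^(frrank i) and the
   differentials are reduced to their constant terms. *)
Definition tor_diff i : 'M[K]_(frrank F i.+1, frrank F i) :=
  map_mx (mcoeff 0%MM) (frdiff F i).

Definition tor_cycles i : 'M[K]_(frrank F i) :=
  match i with
  | 0 => 1%:M
  | j.+1 => kermx (tor_diff j)
  end.

(* The row space of this matrix is the component of degree b of F_i (x) K. *)
Definition tor_degree i (b : 'X_{1..n}) : 'M[K]_(frrank F i) :=
  diag_mx (\row_q (frshift q == b)%:R).

(* [U :\: V] is a complement of U :&: V in U, so this is the dimension of the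
   component of degree b of the i-th homology of F (x) K. *)
Definition tor_dim i (b : 'X_{1..n}) : nat :=
  \rank ((tor_degree i b :&: tor_cycles i) :\: tor_diff i)%MS.

End Tor.

(* beta_{i,b}(N) = k; k does not depend on the resolution. *)
Definition betti_is (N : M -> Prop) i b (k : nat) : Prop :=
  exists F : graded_free_resolution N, tor_dim F i b = k.

(* supp.reg(N) = r, i.e. r is the maximum of the |supp b| - i. *)
Definition suppreg_is (N : M -> Prop) (r : int) : Prop :=
  (exists i b k, [/\ betti_is N i b k, k <> 0%N & (suppdeg b)%:Z - i%:Z = r]) /\
  (forall i b k, betti_is N i b k -> k <> 0%N -> (suppdeg b)%:Z - i%:Z <= r).

(* The submodule N_<d> of N. *)
Definition suppdeg_part (N : M -> Prop) (d : nat) : M -> Prop :=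
  submod_gen (fun x => N x /\ exists2 a, gcomp gM a x & suppdeg a = d).

Definition support_linear (d : nat) (N : M -> Prop) : Prop :=
  (forall x, N x <-> x = 0) \/
  ((forall x, N x <-> suppdeg_part N d x) /\ suppreg_is N d%:Z).

Definition componentwise_support_linear (N : M -> Prop) : Prop :=
  forall d : nat, (d <= n)%N -> support_linear d (suppdeg_part N d).

End GradedModules.

Section MonomialIdeals.
Variables (K : fieldType) (n : nat).
Local Notation S := {mpoly K[n]}.

(* The ideal generated by the monomials with exponent vector in A. *)
Definition mono_ideal (A : 'X_{1..n} -> Prop) : S^o -> Prop :=
  submod_gen (fun f : S^o => exists2 a, A a & f = 'X_[a] :> S).

Definition is_monomial_ideal (I : S^o -> Prop) : Prop :=
  exists A : 'X_{1..n} -> Prop, forall f, I f <-> mono_ideal A f.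

(* A = G(I): A generates I and no proper subset of A does. *)
Definition min_mono_gens (I : S^o -> Prop) (A : 'X_{1..n} -> Prop) : Prop :=
  (forall f, I f <-> mono_ideal A f) /\
  (forall B : 'X_{1..n} -> Prop, (forall a, B a -> A a) ->
     (forall f, I f <-> mono_ideal B f) -> forall a, A a -> B a).

(* <u : u in s> : x^u is generated by a subset of the variables. *)
Definition colon_by_variables (s : seq 'X_{1..n}) (u : 'X_{1..n}) : Prop :=
  exists V : {set 'I_n}, forall f : S,
    mono_ideal (fun a => a \in s) (f * 'X_[u]) <->
    mono_ideal (fun a => exists2 k, k \in V & a = U_(k)%MM) f.

(* s = u_1, ..., u_m is an admissible order of G(I); indices start at 0. *)
Definition admissible_order (I : S^o -> Prop) (s : seq 'X_{1..n}) : Prop :=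
  [/\ uniq s,
      min_mono_gens I (fun a => a \in s) &
      forall i, (0 < i < size s)%N -> colon_by_variables (take i s) (nth 0%MM s i)].

Definition suppdeg_increasing (s : seq 'X_{1..n}) : Prop :=
  sorted leq [seq suppdeg u | u <- s].

End MonomialIdeals.

(* Main.v *)
Require Import Defs.
From HB Require Import structures.
From mathcomp Require Import all_boot all_order all_algebra.
From Stdlib Require Import IndefiniteDescription.

(** Let u_1, ..., u_m be an admissible order of I with increasing
    support-degrees, and let V_j be the set of variables generating the j-th
    colon ideal.

    The component I_<d> has linear quotients too.  It is generated by the
    monomials x^(u_j) * x_F, where F avoids V_j and the support of u_j and
    brings the support-degree up to d.  Ordered by j and then by the sum of the
    elements of F, each of them has a colon ideal by the preceding ones that is
    generated by V_j and by the variables outside the product that are smaller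
    than some element of F ([comp_gen_colon]).  The increase of the
    support-degrees is used to see that a multiple of x^(u_j) * x_F that lies
    in (u_1, ..., u_(j-1)) already lies in the component of that ideal: all the
    earlier generators have support-degree at most d ([comp_gen_cover]).

    An ideal with linear quotients is resolved by a single construction applied
    again and again: if homogeneous elements of a free module have linear
    quotients, then so do their syzygies z_(q,k) = x_k e_q - c, one for each
    variable x_k in the colon ideal of the q-th element ([lq_syzygies]).  The
    degree of z_(q,k) is that of the q-th element plus that of x_k, so that in
    homological degree i all generators have support-degree at most d + i.

    It remains to pass to Betti numbers, which may be computed from any
    resolution.  A comparison of two resolutions up to homotopy shows that no
    Betti number survives in a degree where one of them has no generator
    ([comparison], [tor_dim_eq0]); hence the support-regularity is at most d.
    It is d because a generator of least total degree cannot be a boundary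
    modulo the variables ([tor_dim0_neq0]). *)

Set Implicit Arguments.
Unset Strict Implicit.
Unset Printing Implicit Defensive.

Import GRing.Theory Num.Theory.

(** * Finite sets and supports *)

Lemma sub_card_exists (T : finType) (A : {set T}) e :
  e <= #|A| -> exists2 F : {set T}, F \subset A & #|F| = e.
Proof.
case/card_geqP => s [uniq_s size_s sub_s]; exists [set x in s].
  by apply/subsetP => x; rewrite inE => /sub_s.
by rewrite cardsE (card_uniqP uniq_s).
Qed.

Lemma ltn_lex N x y a b : a < N -> x < y -> x * N + a < y * N + b.
Proof.
move=> lt_a lt_xy; apply: (@leq_trans (x.+1 * N)).
  by rewrite mulSn addnC ltn_add2r.
by apply: leq_trans (leq_addr _ _); rewrite leq_mul2r lt_xy orbT.
Qed.

(** Otherwise every element of G minus F exceeds every element of F minus G,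
    and as both differences have the same size the sum over G is larger.  This
    makes the sets of a given size, listed by increasing sum, behave like the
    generators of a squarefree Veronese ideal in lexicographic order. *)
Lemma exchange_sum n (F G : {set 'I_n}) :
  #|G| = #|F| -> G != F -> \sum_(k in G) k <= \sum_(k in F) k ->
  exists k l : 'I_n, [/\ k \in G, k \notin F, l \in F & k < l].
Proof.
move=> eqGF neqGF le_sum.
have eqD : #|G :\: F| = #|F :\: G|.
  by apply: (@addnI #|G :&: F|); rewrite cardsID setIC cardsID.
have [k0 k0D] : exists k, k \in G :\: F.
  apply/set0Pn; apply: contraNneq neqGF => D0.
  by rewrite eqEcard eqGF leqnn -setD_eq0 D0 eqxx.
case: (@arg_minnP _ k0 (mem (G :\: F)) (fun k => k : nat) k0D) => mu muD min_mu.
have [l /andP[lF lt_mul]|none] := pickP (fun l => (l \in F) && (mu < l)).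
  by exists mu, l; move: muD => /setDP[].
suff: \sum_(k in F :\: G) k + #|F :\: G| <= \sum_(k in G :\: F) k.
  have sumID (A B : {set 'I_n}) : \sum_(k in A) k =
      \sum_(k in A :&: B) k + \sum_(k in A :\: B) (k : nat).
    by rewrite (big_setID B).
  rewrite leqNgt -(ltn_add2l (\sum_(k in G :&: F) k)) -sumID addnA {1}setIC -sumID.
  case/negP; apply: leq_ltn_trans le_sum _.
  rewrite -{1}[\sum_(k in F) k]addn0 ltn_add2l -eqD card_gt0.
  by apply/set0Pn; exists k0.
rewrite -sum1_card -big_split /=; apply: (@leq_trans (\sum_(k in F :\: G) mu)).
  apply: leq_sum => l /setDP[lF lG]; rewrite addn1 ltn_neqAle.
  have := none l; rewrite lF /= => /negbT; rewrite -leqNgt => ->; rewrite andbT.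
  by apply: contraNneq lG => /val_inj ->; case/setDP: muD.
rewrite sum_nat_const -eqD -sum_nat_const.
by apply: leq_sum => k /min_mu.
Qed.

Section Supports.
Variable n : nat.
Implicit Types (a b : 'X_{1..n}) (F : {set 'I_n}).

Lemma in_supp a k : (k \in supp a) = (a k != 0).
Proof. by rewrite inE. Qed.

Lemma suppD a b : supp (a + b)%MM = supp a :|: supp b.
Proof. by apply/setP => k; rewrite !inE mnmDE addn_eq0 negb_and. Qed.

Lemma supp_sub a b : (a <= b)%MM -> supp a \subset supp b.
Proof.
by move/mnm_lepP => le_ab; apply/subsetP => k; rewrite !inE -!lt0n => /leq_trans->.
Qed.

Lemma suppdeg_le a b : (a <= b)%MM -> suppdeg a <= suppdeg b.
Proof. by move/supp_sub/subset_leq_card. Qed.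

Lemma suppdegDU a k : suppdeg (a + U_(k))%MM <= (suppdeg a).+1.
Proof.
rewrite /suppdeg suppD -addn1; apply: leq_trans (leq_card_setU _ _) _.
rewrite leq_add2l (_ : supp U_(k) = [set k]) ?cards1 //.
by apply/setP => j; rewrite !inE mnm1E eqb0 negbK eq_sym.
Qed.

Lemma mnm_le_suppU k a : (U_(k) <= a)%MM = (a k != 0).
Proof.
apply/mnm_lepP/idP => [/(_ k)|ak j]; rewrite mnm1E ?eqxx -?lt0n //.
by case: eqP => [<-|//]; rewrite lt0n.
Qed.

Definition sqfree_mnm F : 'X_{1..n} := [multinom (k \in F : nat) | k < n].

Lemma sqfree_mnmE F k : sqfree_mnm F k = (k \in F).
Proof. by rewrite mnmE. Qed.

Lemma supp_sqfree F : supp (sqfree_mnm F) = F.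
Proof. by apply/setP => k; rewrite in_supp sqfree_mnmE eqb0 negbK. Qed.

End Supports.

(** * Linear quotients of a support component *)

(** Here u lists the generators of an ideal with linear quotients, V j is the
    set of variables generating the j-th colon ideal, and support-degrees do
    not decrease along u.  The ideal generated by the monomials of the ideal of
    support-degree d is generated by the products x^(u j) * x_F, where F has
    the size that brings the support-degree up to d and avoids both the support
    of u j and V j: a factor in V j would make the product a multiple of an
    earlier u i.  Below, these products are shown to have linear quotients. *)
Section SupportComponent.
Variables (n l : nat) (u : 'I_l -> 'X_{1..n}) (V : 'I_l -> {set 'I_n}).
Hypothesis colon_u : forall (j : 'I_l) a,
  (exists2 i : 'I_l, i < j & (u i <= a + u j)%MM) <->
  (exists2 k, k \in V j & a k != 0).
Hypothesis incr_u : forall i j : 'I_l, i <= j -> suppdeg (u i) <= suppdeg (u j).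
Variable d : nat.

Definition comp_index : {set 'I_l * {set 'I_n}} :=
  [set x : 'I_l * {set 'I_n} |
    [&& [disjoint x.2 & supp (u x.1)], [disjoint x.2 & V x.1]
      & suppdeg (u x.1) + #|x.2| == d]].

Implicit Types x y : 'I_l * {set 'I_n}.

Lemma comp_indexP x :
  reflect [/\ forall k, k \in x.2 -> u x.1 k = 0,
              forall k, k \in x.2 -> k \notin V x.1 &
              suppdeg (u x.1) + #|x.2| = d] (x \in comp_index).
Proof.
rewrite inE !disjoints_subset; apply: (iffP and3P) => -[].
  move=> /subsetP sF /subsetP vF /eqP ->; split=> // k kF; last first.
    by have := vF _ kF; rewrite inE.
  by have := sF _ kF; rewrite !inE negbK => /eqP.
move=> sF vF ->; split=> //; apply/subsetP => k kF; rewrite !inE ?vF // sF //.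
Qed.

Definition comp_gen (x : 'I_l * {set 'I_n}) : 'X_{1..n} := (u x.1 + sqfree_mnm x.2)%MM.

(** The products are ordered by j, then by the sum of the elements of F; the
    rank of F only breaks the remaining ties.  The three criteria are packed in
    one number, in mixed radix. *)
Definition comp_key (x : 'I_l * {set 'I_n}) : nat :=
  (x.1 * (n * n).+1 + \sum_(k in x.2) k) * #|{set 'I_n}| + enum_rank x.2.

(** The variables generating the colon ideal of x^(u j) * x_F: those of V j lead
    back to an earlier u i, and those outside the support of the product but
    smaller than some element of F lead to a set of smaller sum. *)
Definition comp_var (x : 'I_l * {set 'I_n}) : {set 'I_n} :=
  V x.1 :|: [set k | [&& k \notin x.2, u x.1 k == 0, k \notin V x.1
                       & [exists j in x.2, k < j]]].

Lemma sum_set_lt (F : {set 'I_n}) : \sum_(k in F) k < (n * n).+1.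
Proof.
rewrite ltnS; apply: (@leq_trans (\sum_(k < n) n)).
  by rewrite big_mkcond; apply: leq_sum => k _; case: ifP => // _; apply: ltnW.
by rewrite sum_nat_const card_ord.
Qed.

Lemma comp_key_lt1 x y : x.1 < y.1 -> comp_key x < comp_key y.
Proof. by move=> lt_xy; apply/ltn_lex/ltn_lex/lt_xy/sum_set_lt. Qed.

Lemma comp_key_lt2 x y :
  x.1 = y.1 -> \sum_(k in x.2) k < \sum_(k in y.2) k -> comp_key x < comp_key y.
Proof. by move=> eq_xy lt_xy; apply: ltn_lex; rewrite // eq_xy ltn_add2l. Qed.

Lemma comp_key_ltP x y : comp_key x < comp_key y ->
  x.1 < y.1 \/ x.1 = y.1 /\ \sum_(k in x.2) k <= \sum_(k in y.2) k.
Proof.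
move=> lt_xy; case: (ltngtP x.1 y.1) => [|/comp_key_lt1|/val_inj eq_xy]; first by left.
  by rewrite ltnNge ltnW.
right; split=> //; rewrite leqNgt; apply: contraL lt_xy => lt_yx.
by rewrite -leqNgt ltnW // comp_key_lt2.
Qed.

Lemma comp_key_inj : injective comp_key.
Proof.
move=> x y eq_xy.
have nlt x' y' : comp_key x' = comp_key y' ->
    x'.1 <= y'.1 /\ (x'.1 = y'.1 -> \sum_(k in x'.2) k <= \sum_(k in y'.2) k).
  move=> eq'; split=> [|eq1]; rewrite leqNgt; apply/negP.
    by move/comp_key_lt1; rewrite eq' ltnn.
  by move/(comp_key_lt2 (esym eq1)); rewrite eq' ltnn.
have [le1 le2] := nlt _ _ eq_xy; have [ge1 ge2] := nlt _ _ (esym eq_xy).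
have eq1 : x.1 = y.1 by apply/val_inj/anti_leq; rewrite le1 ge1.
have eq2 : \sum_(k in x.2) k = \sum_(k in y.2) k.
  by apply/anti_leq; rewrite le2 ?ge2.
move: eq_xy; rewrite /comp_key eq1 eq2 => /addnI/val_inj/enum_rank_inj.
by case: x y eq1 {eq2 le1 le2 ge1 ge2} => [? ?] [? ?] /= -> ->.
Qed.

Lemma suppdeg_comp_gen x : x \in comp_index -> suppdeg (comp_gen x) = d.
Proof.
case/comp_indexP => disj _ <-; rewrite /suppdeg suppD supp_sqfree cardsU.
rewrite (_ : _ :&: _ = set0) ?cards0 ?subn0 //; apply/setP => k.
by rewrite !inE; apply/negP => /andP[nz /disj u0]; rewrite u0 in nz.
Qed.

(** Take the first u i dividing a.  No variable of V i divides a / x^(u i), since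
    otherwise an earlier generator would divide a; so the missing part F of the
    support can be chosen in the support of a, away from u i and V i. *)
Lemma comp_gen_cover (j : 'I_l) a :
  (u j <= a)%MM -> suppdeg (u j) <= d -> d <= suppdeg a ->
  exists x, [/\ x \in comp_index, x.1 <= j & (comp_gen x <= a)%MM].
Proof.
move def_N: (j : nat) => N; elim/ltn_ind: N j def_N.
move=> N IHN j def_N dvd_j le_d ge_d; subst N.
have [i /andP[lt_ij dvd_i]|none] := pickP (fun i : 'I_l => (i < j) && (u i <= a)%MM).
  have [|x [Tx le_xi dvd_x]] := IHN i lt_ij i erefl dvd_i _ ge_d.
    by apply: leq_trans (incr_u (ltnW lt_ij)) le_d.
  by exists x; split=> //; apply: leq_trans le_xi (ltnW lt_ij).
have [|F subF cardF] := @sub_card_exists _ (supp a :\: supp (u j)) (d - suppdeg (u j)).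
  by rewrite cardsD (setIidPr (supp_sub dvd_j)) leq_sub2r.
have disjF k : k \in F -> u j k = 0 /\ a k != 0.
  by move/(subsetP subF); rewrite !inE negbK => /andP[/eqP].
exists (j, F); split=> //.
  apply/comp_indexP; split=> [k /disjF[]|k /disjF[uk ak]|] //=; last first.
    by rewrite cardF subnKC.
  apply/negP => Vk; have [|i lt_ij dvd_i] := (colon_u j (a - u j)%MM).2.
    by exists k; rewrite // mnmBE uk subn0.
  by have := none i; rewrite lt_ij /= -(submK dvd_j) dvd_i.
apply/mnm_lepP => k; rewrite mnmDE sqfree_mnmE /=.
have [/disjF[-> ak]|_] := boolP (k \in F); first by rewrite lt0n.
by rewrite addn0; apply/mnm_lepP: k.
Qed.

(** If an earlier product divides a * x^(u j) * x_F, either it lies over an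
    earlier u i, and a variable of V j divides a * x_F, hence a as F avoids V j;
    or it lies over u j, and [exchange_sum] gives a variable of a.  Conversely,
    for k in V j the monomial x_k * x^(u j) * x_F is a multiple of an earlier
    u i and has support-degree at least d.  As the support-degrees increase
    along u, that of u i is at most d, so [comp_gen_cover] applies. *)
Lemma comp_gen_colon x a : x \in comp_index ->
  (exists y, [/\ y \in comp_index, comp_key y < comp_key x
                & (comp_gen y <= a + comp_gen x)%MM]) <->
  (exists2 k, k \in comp_var x & a k != 0).
Proof.
case: x => [j F] Tx; have [/= disjF VF cardF] := comp_indexP _ Tx; split.
  case=> [[i G] [Ty lt_yx dvd_y]]; have [/= disjG VG cardG] := comp_indexP _ Ty.
  case/comp_key_ltP: (lt_yx) => /= [lt_ij|[eq_ij le_GF]].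
    have [|k Vk] := (colon_u j (a + sqfree_mnm F)%MM).1.
      exists i => //; rewrite -addmA [(sqfree_mnm F + _)%MM]addmC.
      by apply: lepm_trans dvd_y; apply: lem_addr.
    rewrite mnmDE sqfree_mnmE addn_eq0 negb_and => nz.
    exists k; first by rewrite inE Vk.
    by case/orP: nz => //; rewrite eqb0 negbK => /VF; rewrite Vk.
  subst i; have neqGF : G != F.
    by apply: contraTneq lt_yx => ->; rewrite ltnn.
  (* The two products share u j, so F and G have the same size. *)
  have eqGF : #|G| = #|F| by apply: (@addnI (suppdeg (u j))); rewrite cardG cardF.
  have [k [h [Gk Fk Fh lt_kh]]] := exchange_sum eqGF neqGF le_GF.
  exists k.
    rewrite !inE /= disjG // eqxx Fk VG //=; apply/orP; right.
    by apply/existsP; exists h; rewrite Fh.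
  have /mnm_lepP/(_ k) := dvd_y.
  by rewrite !mnmDE !sqfree_mnmE Gk (negPf Fk) disjG // addn0 lt0n.
case=> k; have [Vk _ ak|Vk] := boolP (k \in V j).
  have [|i lt_ij dvd_i] := (colon_u j U_(k)%MM).2.
    by exists k; rewrite // mnm1E eqxx.
  have dvd_i' : (u i <= a + comp_gen (j, F))%MM.
    apply: lepm_trans dvd_i _; rewrite /comp_gen addmA.
    apply/mnm_lepP => k'; rewrite !mnmDE; apply: leq_trans (leq_addr _ _).
    by rewrite leq_add2r; move: k'; apply/mnm_lepP; rewrite mnm_le_suppU.
  have [||y [Ty le_yi dvd_y]] := comp_gen_cover dvd_i'.
  - by apply: leq_trans (incr_u (ltnW lt_ij)) _; rewrite -cardF leq_addr.
  - by rewrite -(suppdeg_comp_gen Tx) suppdeg_le // lem_addl.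
  by exists y; split=> //; apply/comp_key_lt1/(leq_ltn_trans le_yi).
rewrite !inE (negPf Vk) /= => /and3P[Fk /eqP uk /existsP[h /andP[Fh lt_kh]]] ak.
have neq_hk : h != k by apply: contraNneq Fk => <-.
(* Exchanging h for the smaller k lowers the sum. *)
exists (j, k |: F :\ h); split.
- apply/comp_indexP; split=> /= [k'|k'|].
  + by rewrite !inE => /orP[/eqP->|/andP[_ /disjF]].
  + by rewrite !inE => /orP[/eqP->|/andP[_ /VF]].
  by rewrite cardsU1 !inE (negPf Fk) andbF -cardF (cardsD1 h F) Fh.
- apply: comp_key_lt2 => //=; rewrite big_setU1 ?inE ?(negPf Fk) ?andbF //=.
  by rewrite [X in _ < X](big_setD1 h) //= ltn_add2r.
apply/mnm_lepP => k'; rewrite !mnmDE !sqfree_mnmE !inE addnCA leq_add2l.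
have [->|_] := eqVneq k' k; first by rewrite (negPf Fk) addn0 lt0n.
by apply: leq_trans (leq_addl _ _); case: (_ == h).
Qed.

End SupportComponent.

Local Open Scope ring_scope.

(** * Homogeneous matrices over the polynomial ring *)

Section HomogeneousMatrices.
Variables (K : fieldType) (n : nat).
Local Notation S := {mpoly K[n]}.
Implicit Types (a b c : 'X_{1..n}) (f g : S).

Lemma mpolyX_neq0 a : 'X_[a] != 0 :> S.
Proof. by rewrite -msupp_eq0 msuppX. Qed.

(** When f is seen as an entry of a matrix with row degree a and column degree
    b, its homogeneous part is the term of degree a - b.  Multiplying by x^b
    turns it into the term of degree a of f * x^b, which avoids case analyses
    on divisibility. *)
Definition hpart a b f : S :=
  if (b <= a)%MM then f@_(a - b) *: 'X_[a - b] else 0.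

Lemma hpart_mulX a b f : hpart a b f * 'X_[b] = (f * 'X_[b])@_a *: 'X_[a].
Proof.
rewrite /hpart; case: ifP => [le_ba|/negP nle_ba].
  by rewrite -scalerAl -mpolyXD submK // -(mcoeffMX _ b) [(b + _)%MM]addmC submK.
rewrite mul0r (_ : _@_a = 0) ?scale0r //; apply/eqP; rewrite mcoeff_eq0.
apply/negP; rewrite (perm_mem (msuppMX _ _)) => /mapP[m _ def_a].
by apply: nle_ba; rewrite def_a lem_addr.
Qed.

Lemma scomp_hpart a b f : scomp a (hpart a b f * 'X_[b]).
Proof. by rewrite hpart_mulX; eexists. Qed.

Lemma hpart_id a b f : scomp a (f * 'X_[b]) -> hpart a b f = f.
Proof.
case=> c def_f; apply: (mulIf (mpolyX_neq0 b)).
by rewrite hpart_mulX def_f mcoeffZ mcoeffX eqxx mulr1.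
Qed.

Lemma hpart_mul a b c f g :
  scomp b (g * 'X_[c]) -> hpart a c (f * g) = hpart a b f * g.
Proof.
case=> e def_g; apply: (mulIf (mpolyX_neq0 c)).
rewrite hpart_mulX -!mulrA def_g -!scalerAr hpart_mulX mcoeffZ scalerA //.
Qed.

Lemma hpart0 a b : hpart a b 0 = 0.
Proof. by rewrite /hpart mcoeff0 scale0r if_same. Qed.

Lemma hpart_is_additive a b : additive (hpart a b).
Proof.
move=> f g; rewrite /hpart; case: ifP => _; last by rewrite subr0.
by rewrite mcoeffB scalerBl.
Qed.

HB.instance Definition _ a b :=
  GRing.isAdditive.Build S S (hpart a b) (hpart_is_additive a b).

(** Matrices of homogeneous maps between free modules whose basis vectors have
    the degrees al (source) and be (target). *)
Definition mx_homog m r (al : 'I_m -> 'X_{1..n}) (be : 'I_r -> 'X_{1..n})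
    (A : 'M[S]_(m, r)) :=
  forall p q, scomp (al p) (A p q * 'X_[be q]).

Definition mx_hpart m r (al : 'I_m -> 'X_{1..n}) (be : 'I_r -> 'X_{1..n})
    (A : 'M[S]_(m, r)) :=
  \matrix_(p, q) hpart (al p) (be q) (A p q).

Lemma mx_homog_hpart m r al be (A : 'M[S]_(m, r)) :
  mx_homog al be (mx_hpart al be A).
Proof. by move=> p q; rewrite mxE; apply: scomp_hpart. Qed.

Lemma mx_hpart_mul m r s al be ga (A : 'M[S]_(m, r)) (B : 'M[S]_(r, s)) :
  mx_homog be ga B -> mx_hpart al ga (A *m B) = mx_hpart al be A *m B.
Proof.
move=> hB; apply/matrixP => p q; rewrite !mxE raddf_sum /=.
by apply: eq_bigr => j _; rewrite mxE (hpart_mul _ _ (hB j q)).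
Qed.

(** Taking homogeneous parts commutes with multiplication by a homogeneous
    matrix, so a factorization between homogeneous matrices can be made
    homogeneous without creating new nonzero entries. *)
Lemma mx_homog_factor m r s al be ga
    (A : 'M[S]_(m, s)) (C : 'M[S]_(m, r)) (B : 'M[S]_(r, s)) :
  mx_homog al ga A -> mx_homog be ga B -> A = C *m B ->
  exists C', [/\ mx_homog al be C', A = C' *m B &
                 forall p q, C p q = 0 -> C' p q = 0].
Proof.
move=> hA hB defA; exists (mx_hpart al be C); split; first exact: mx_homog_hpart.
  rewrite -(mx_hpart_mul _ _ hB) -defA.
  by apply/matrixP => p q; rewrite mxE hpart_id.
by move=> p q C0; rewrite mxE C0 hpart0.
Qed.

Lemma mx_homog_mul m r s al be ga (A : 'M[S]_(m, r)) (B : 'M[S]_(r, s)) :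
  mx_homog al be A -> mx_homog be ga B -> mx_homog al ga (A *m B).
Proof.
move=> hA hB p q; rewrite mxE mulr_suml.
apply: (big_ind (scomp (al p))) => [|f g|j _]; first exact: scomp0.
  exact: scompD.
have [d def_d] := hB j q; have [c def_c] := hA p j.
by exists (d * c); rewrite -mulrA def_d -scalerAr def_c scalerA.
Qed.

Lemma mx_homog_mcoeff0 m r al be (A : 'M[S]_(m, r)) p q :
  mx_homog al be A -> al p != be q -> (A p q)@_0 = 0.
Proof.
move=> hA neq; rewrite -(mcoeffMX _ (be q)) addm0; have [c ->] := hA p q.
by rewrite mcoeffZ mcoeffX (negPf neq) mulr0.
Qed.

End HomogeneousMatrices.

(** * Betti numbers vanish independently of the resolution *)

Section Comparison.
Variables (K : fieldType) (n : nat) (N : ({mpoly K[n]}^o)%type -> Prop).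
Local Notation S := {mpoly K[n]}.
Local Notation resolution := (graded_free_resolution (sgrading K n) N).
Implicit Types F G : resolution.

Definition augmx F : 'M[S]_(frrank F 0, 1) :=
  \matrix_(q, _) (@fraug K n _ _ N F q : S^o).

Lemma mul_augmx F (v : 'rV[S]_(frrank F 0)) :
  v *m augmx F = (\sum_q v 0 q *: @fraug K n _ _ N F q : S^o)%:M.
Proof.
apply/matrixP => i j; rewrite !mxE !ord1 eqxx mulr1n.
by apply: eq_bigr => q _; rewrite mxE.
Qed.

Lemma augmx_homog F : mx_homog (@frshift K n _ _ N F 0) (fun=> 0%MM) (augmx F).
Proof. by move=> p q; rewrite mxE mpolyX0 mulr1; apply: (fraug_homog p). Qed.

(** The cycles of the augmented resolution, so that the augmentation and the
    differentials are treated alike. *)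
Definition rescycle F i : 'rV[S]_(frrank F i) -> Prop :=
  match i with
  | 0 => fun v => v *m augmx F = 0
  | j.+1 => fun v => v *m frdiff F j = 0
  end.

Lemma scalar_mx1_eq0 (f : S) : (f%:M == 0 :> 'M_1) = (f == 0).
Proof.
apply/eqP/eqP => [/matrixP/(_ 0 0)|->]; last by rewrite raddf0.
by rewrite !mxE eqxx mulr1n.
Qed.

Lemma rescycle_exact F i (v : 'rV_(frrank F i)) :
  rescycle v <-> exists w, v = w *m frdiff F i.
Proof.
case: i v => [|i] v /=; last exact: fr_exactS.
rewrite -fr_exact0 mul_augmx; split=> [/eqP|->]; last by rewrite raddf0.
by rewrite scalar_mx1_eq0 => /eqP.
Qed.

Lemma rescycle_diff F i k : rescycle (row k (frdiff F i)).
Proof. by apply/rescycle_exact; exists (delta_mx 0 k); rewrite -rowE. Qed.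

Lemma rescycle_lift F i m (A : 'M_(m, frrank F i)) :
  (forall k, rescycle (row k A)) -> exists B, A = B *m frdiff F i.
Proof.
move=> cycA.
have [k|w def_w] := @fin_all_exists _ _
    (fun (k : 'I_m) (w : 'rV_(frrank F i.+1)) => row k A = w *m frdiff F i).
  exact/rescycle_exact.
exists (\matrix_k w k); apply/row_matrixP => k.
by rewrite row_mul rowK -def_w.
Qed.

Lemma augmx_factor F G : exists C, augmx F = C *m augmx G.
Proof.
pose P (p : 'I_(frrank F 0)) (w : 'rV_(frrank G 0)) :=
  fraug p = \sum_q w 0 q *: fraug q.
have [p|w def_w] := @fin_all_exists _ _ P.
  apply/fr_onto/(fr_onto F); exists (delta_mx 0 p).
  rewrite (bigD1 p) //= mxE !eqxx scale1r big1 ?addr0 // => q /negPf neq.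
  by rewrite mxE neq andbF scale0r.
exists (\matrix_p w p); apply/row_matrixP => p.
rewrite row_mul rowK mul_augmx -def_w; apply/matrixP => i j.
by rewrite !mxE !ord1 eqxx mulr1n.
Qed.

(** The comparison theorem in homological degree i.  The matrix e stands for the
    second half d *m h of the homotopy, where h comes from the preceding degree
    and is absent in degree 0.  Since d kills cycles, so does e, which allows
    the construction to be continued; and the reduction of e modulo the
    variables kills the cycles of the reduced complex, which is how e drops out
    of the computation of Tor. *)
Lemma comparison F G i :
  exists (phi : 'M_(frrank F i, frrank G i)) (psi : 'M_(frrank G i, frrank F i))
      (h : 'M_(frrank F i, frrank F i.+1)) (e : 'M_(frrank F i)),
    [/\ mx_homog (@frshift K n _ _ N F i) (@frshift K n _ _ N G i) phi,
        forall v, rescycle v -> rescycle (v *m phi),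
        forall v, rescycle v -> rescycle (v *m psi),
        1%:M = phi *m psi + h *m frdiff F i + e &
        (forall v, rescycle v -> v *m e = 0) /\
        tor_cycles F i *m map_mx (mcoeff 0%MM) e = 0].
Proof.
elim: i => [|i [phi [psi [h [e [homphi cycphi cycpsi def1 [ecyc etor]]]]]]].
  have [phi0 def_phi0] := augmx_factor F G; have [psi def_psi] := augmx_factor G F.
  have [phi [homphi def_phi _]] :=
    mx_homog_factor (@augmx_homog F) (@augmx_homog G) def_phi0.
  have [k|h def_h] := @rescycle_lift F 0 _ (1%:M - phi *m psi).
    rewrite /= -row_mul mulmxBl mul1mx -mulmxA -def_psi -def_phi subrr.
    by rewrite row0.
  exists phi, psi, h, 0; split=> //.
  - by move=> v /=; rewrite -mulmxA -def_phi.
  - by move=> v /=; rewrite -mulmxA -def_psi.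
  - by rewrite -def_h addr0 addrC subrK.
  - by split=> [v _|]; rewrite ?raddf0 ?mulmx0.
have [k|phi0 def_phi0] := @rescycle_lift G i _ (frdiff F i *m phi).
  by rewrite row_mul; apply/cycphi/rescycle_diff.
have homd : mx_homog (@frshift K n _ _ N F i.+1) (@frshift K n _ _ N F i) (frdiff F i).
  exact: frdiff_homog.
have homdG : mx_homog (@frshift K n _ _ N G i.+1) (@frshift K n _ _ N G i) (frdiff G i).
  exact: frdiff_homog.
have [phi' [homphi' def_phi' _]] :=
  mx_homog_factor (mx_homog_mul homd homphi) homdG def_phi0.
have [k|psi' def_psi'] := @rescycle_lift F i _ (frdiff G i *m psi).
  by rewrite row_mul; apply/cycpsi/rescycle_diff.
have de0 : frdiff F i *m e = 0.
  by apply/row_matrixP => k; rewrite row_mul ecyc ?row0 //; apply: rescycle_diff.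
(* The identity of degree i, composed with the differential, makes the new
   defect 1 - phi' psi' - d h a matrix of cycles. *)
have splitd : frdiff F i =
    frdiff F i *m phi *m psi + frdiff F i *m h *m frdiff F i.
  by rewrite -{1}[frdiff F i]mulmx1 def1 !mulmxDr de0 addr0 !mulmxA.
have [k|h' def_h'] := @rescycle_lift F i.+1 _ (1%:M - phi' *m psi' - frdiff F i *m h).
  rewrite /= -row_mul 2!mulmxBl mul1mx -!mulmxA -def_psi' !mulmxA -def_phi'.
  by rewrite {1}splitd (addrC (_ *m phi *m psi)) addrK subrr row0.
exists phi', psi', h', (frdiff F i *m h); split=> //.
- by move=> v /= cyc_v; rewrite -mulmxA -def_phi' mulmxA cyc_v mul0mx.
- by move=> v /= cyc_v; rewrite -mulmxA -def_psi' mulmxA cyc_v mul0mx.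
- by rewrite -def_h' -addrA subrK addrC subrK.
split=> [v /= cyc_v|]; first by rewrite mulmxA cyc_v mul0mx.
by rewrite map_mxM /= mulmxA mulmx_ker mul0mx.
Qed.

(** Modulo the variables, a cycle z of degree b equals z phi psi plus a
    boundary.  As phi preserves degrees, z phi involves only generators of G of
    degree b, and there are none. *)
Lemma tor_dim_eq0 F G i b :
  (forall q : 'I_(frrank G i), frshift q != b) -> tor_dim F i b = 0%N.
Proof.
move=> nogen; have [phi [psi [h [e [homphi _ _ def1 [_ etor]]]]]] := comparison F G i.
set Z := (tor_degree F i b :&: tor_cycles F i)%MS.
have phi0 : tor_degree F i b *m map_mx (mcoeff 0%MM) phi = 0.
  apply/matrixP => p q; rewrite mul_diag_mx !mxE.
  have [def_b|] := eqVneq; last by rewrite mul0r.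
  by rewrite mul1r (mx_homog_mcoeff0 homphi) // def_b eq_sym.
have Zphi : Z *m map_mx (mcoeff 0%MM) phi = 0.
  have /submxP[A ->] : (Z <= tor_degree F i b)%MS by apply: capmxSl.
  by rewrite -mulmxA phi0 mulmx0.
have Ze : Z *m map_mx (mcoeff 0%MM) e = 0.
  have /submxP[A ->] : (Z <= tor_cycles F i)%MS by apply: capmxSr.
  by rewrite -mulmxA etor mulmx0.
have subZ : (Z <= tor_diff F i)%MS.
  have -> : Z = Z *m map_mx (@mcoeff n K 0%MM) 1%:M by rewrite map_mx1 mulmx1.
  rewrite def1 !map_mxD !map_mxM /= !mulmxDr Ze addr0 !mulmxA Zphi mul0mx add0r.
  exact: submxMl.
apply/eqP; rewrite /tor_dim -/Z -(eqn_add2l (\rank (Z :&: tor_diff F i)%MS)).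
by rewrite mxrank_cap_compl addn0 (capmx_idPl subZ).
Qed.

End Comparison.

(** * Ideals generated by variables *)

Section VariableIdeals.
Variables (K : fieldType) (n : nat).
Local Notation S := {mpoly K[n]}.
Implicit Types (V : {set 'I_n}) (f g : S).

(** The ideal generated by the variables in V, described through the monomials
    of its elements, so that colon ideals by a variable can be read off. *)
Definition var_ideal V f :=
  forall a, f@_a != 0 -> exists2 k, k \in V & a k != 0%N.

Lemma var_ideal0 V : var_ideal V 0.
Proof. by move=> a; rewrite mcoeff0 eqxx. Qed.

Lemma var_idealD V f g : var_ideal V f -> var_ideal V g -> var_ideal V (f + g).
Proof.
move=> Vf Vg a; rewrite mcoeffD; have [->|nz _] := eqVneq f@_a 0; last exact: Vf.
by rewrite add0r; apply: Vg.
Qed.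

Lemma var_ideal_mulX V k f : k \in V -> var_ideal V (f * 'X_k).
Proof.
move=> Vk a; rewrite -mcoeff_msupp (perm_mem (msuppMX _ _)) => /mapP[b _ ->].
by exists k; rewrite // mnmDE mnm1E eqxx.
Qed.

Lemma var_idealP V f :
  var_ideal V f <-> exists h : 'I_n -> S, f = \sum_(k in V) h k * 'X_k.
Proof.
split=> [Vf|[h ->]]; last first.
  apply: (big_ind (var_ideal V)) => [|g1 g2|k Vk]; first exact: var_ideal0.
    exact: var_idealD.
  exact: var_ideal_mulX.
rewrite [f]mpolyE big_seq.
apply: (big_ind (fun g => exists h : 'I_n -> S, g = \sum_(k in V) h k * 'X_k)).
- by exists (fun=> 0); rewrite big1 // => k _; rewrite mul0r.
- move=> _ _ [h ->] [h' ->]; exists (fun k => h k + h' k).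
  by rewrite -big_split; apply: eq_bigr => k _; rewrite mulrDl.
move=> a; rewrite mcoeff_msupp => /Vf[k Vk ak].
exists (fun k' => if k' == k then f@_a *: 'X_[a - U_(k)] else 0).
rewrite (bigD1 k) //= eqxx big1 ?addr0 => [|k' /andP[_ /negPf->]]; last by rewrite mul0r.
rewrite -scalerAl -mpolyXD submK //; apply/mnm_lepP => j; rewrite mnm1E.
by case: eqP => [<-|//]; rewrite lt0n.
Qed.

Lemma var_ideal_colon V k f : k \notin V -> var_ideal V (f * 'X_k) -> var_ideal V f.
Proof.
move=> Vk Vfk a fa; have [|k' Vk'] := Vfk (U_(k) + a)%MM; first by rewrite mcoeffMX.
rewrite mnmDE mnm1E; have [kk'|_] := eqVneq k k'; last by exists k'.
by rewrite kk' Vk' in Vk.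
Qed.

End VariableIdeals.

(** * Linear quotients and their syzygies *)

Section LinearQuotients.
Variables (K : fieldType) (n : nat).
Local Notation S := {mpoly K[n]}.

Definition below m (key : 'I_m -> nat) (x : nat) (c : 'rV[S]_m) :=
  forall p, c 0 p != 0 -> (key p < x)%N.

Lemma belowD m (key : 'I_m -> nat) x c d :
  below key x c -> below key x d -> below key x (c + d).
Proof.
move=> bc bd p; rewrite mxE; have [->|nz _] := eqVneq (c 0 p) 0; last exact: bc.
by rewrite add0r; apply: bd.
Qed.

Lemma below_trans m (key : 'I_m -> nat) x y c :
  (x <= y)%N -> below key x c -> below key y c.
Proof. by move=> le_xy bc p /bc lt_px; apply: leq_trans le_xy. Qed.

(** Homogeneous elements of a free module, the rows of [lq_gen], such that the
    colon ideal of each one by the preceding ones is generated by variables.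
    Precedence is given by an injective numbering rather than by the row index,
    so that the syzygies can be enumerated in any order. *)
Record lq_system r (be : 'I_r -> 'X_{1..n}) := LqSystem {
  lq_rank : nat;
  lq_deg : 'I_lq_rank -> 'X_{1..n};
  lq_gen : 'M[S]_(lq_rank, r);
  lq_key : 'I_lq_rank -> nat;
  lq_var : 'I_lq_rank -> {set 'I_n};
  lq_homog : mx_homog lq_deg be lq_gen;
  lq_key_inj : injective lq_key;
  lq_colon : forall q f,
    (exists2 c, below lq_key (lq_key q) c & f *: row q lq_gen = c *m lq_gen)
    <-> var_ideal (lq_var q) f
}.

Section Syzygies.
Variables (r : nat) (be : 'I_r -> 'X_{1..n}) (s : lq_system be).
Local Notation m := (lq_rank s).
Local Notation g := (lq_gen s).
Local Notation key := (@lq_key _ _ s).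
Local Notation deg := (@lq_deg _ _ s).
Local Notation V := (@lq_var _ _ s).

(** The syzygy x_k e_q - c, where c expresses x_k times the q-th generator by
    earlier ones.  Making c homogeneous keeps it supported on these, so x_k e_q
    is the last term of the syzygy; this is all that is recorded about c. *)
Lemma lq_syzygy (x : 'I_m * 'I_n) : exists z : 'rV[S]_m,
  x.2 \in V x.1 ->
  [/\ z *m g = 0, mx_homog (fun=> deg x.1 + U_(x.2))%MM deg z,
      z 0 x.1 = 'X_x.2 &
      forall p, (key x.1 < key p)%N -> z 0 p = 0].
Proof.
case: x => q k /=; have [Vk|] := boolP (k \in V q); last by exists 0.
have [|c0 bc0 def_c0] := (lq_colon q 'X_k).2.
  by rewrite -['X_k]mul1r; apply: var_ideal_mulX.
have homX : mx_homog (fun=> deg q + U_(k))%MM be ('X_k *: row q g).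
  move=> i j; rewrite !mxE -mulrA; have [c ->] := lq_homog q j.
  by exists c; rewrite -scalerAr -mpolyXD addmC.
have [c [homc def_c c0c]] := mx_homog_factor homX (@lq_homog _ _ s) def_c0.
have bc p : (key q <= key p)%N -> c 0 p = 0.
  by move=> le_qp; apply/c0c/eqP; apply: contraTT le_qp => /bc0; rewrite -ltnNge.
exists ('X_k *: delta_mx 0 q - c) => _; split.
- by rewrite mulmxBl -scalemxAl -rowE def_c subrr.
- move=> i p; rewrite !mxE ord1 eqxx /= mulrBl.
  have [d ->] := homc 0 p; have [->|_] := eqVneq p q.
    by exists (1 - d); rewrite mulr1 -mpolyXD addmC scalerBl scale1r.
  by exists (- d); rewrite mulr0 mul0r sub0r scaleNr.
- by rewrite !mxE !eqxx mulr1 bc // subr0.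
move=> p lt_qp; rewrite !mxE bc ?(ltnW lt_qp) // subr0 eqxx /=.
by case: eqP lt_qp => [->|_]; rewrite ?ltnn ?mulr0.
Qed.

(** The class of linear quotients is stable under syzygies.  The syzygies
    z_(q,k) = x_k e_q - c_(q,k), with x_k in the colon ideal of the q-th
    generator, are ordered by q and then by k.  Looking at the last coordinate
    shows by descent that they generate, and that the colon ideal of z_(q,k)
    by the earlier ones is that of x_k by the x_k' with k' < k, which these x_k'
    generate.  Degrees grow by one variable. *)
Lemma lq_syzygies : exists t : lq_system deg,
  (forall v : 'rV_m, v *m g = 0 <-> exists w, v = w *m lq_gen t) /\
  (forall p, exists q k, lq_deg (l := t) p = (deg q + U_(k))%MM).
Proof.
have [z zP] := fin_all_exists lq_syzygy.
pose A := [set x : 'I_m * 'I_n | x.2 \in V x.1].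
have zA x : x \in A -> x.2 \in V x.1 by rewrite inE.
pose idx (a : 'I_#|A|) := enum_val a.
have idxA a : (idx a).2 \in V (idx a).1 by apply/zA/enum_valP.
pose g' := \matrix_(a < #|A|) z (idx a).
pose key' a := (key (idx a).1 * n + (idx a).2)%N.
pose V' a := [set k in V (idx a).1 | (k < (idx a).2)%N].
have zg q k : k \in V q -> z (q, k) *m g = 0 by move/(zP (q, k)) => [].
have zdiag q k : k \in V q -> z (q, k) 0 q = 'X_k by move/(zP (q, k)) => [].
have zhigh q k p : k \in V q -> (key q < key p)%N -> z (q, k) 0 p = 0.
  by move/(zP (q, k)) => [_ _ _]; apply.
have slice q (h : 'I_n -> S) :
  (\row_a (if (idx a).1 == q then h (idx a).2 else 0)) *m g' =
  \sum_(k in V q) h k *: z (q, k).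
  rewrite mulmx_sum_row.
  under eq_bigr => a _ do rewrite mxE rowK.
  rewrite -(big_enum_val (fun x => (if x.1 == q then h x.2 else 0) *: z x)).
  transitivity (\sum_(x | (x.1 == q) && (x.2 \in V x.1)) h x.2 *: z (x.1, x.2)).
    rewrite [RHS]big_mkcondl; apply: eq_big => [x|[q' k] _ /=]; first by rewrite inE.
    by case: ifP => // _; rewrite scale0r.
  by rewrite -(pair_big_dep (pred1 q) (fun q k => k \in V q)
       (fun q k => h k *: z (q, k))) /= big_pred1_eq.
(* A syzygy below N is a combination of the z_(q,k) with q below N: its last
   coordinate lies in the colon ideal, so subtracting suitable multiples of the
   z_(q,k) lowers N. *)
have lift N v : below key N v -> v *m g = 0 ->
    exists2 w, below key' (N * n) w & v = w *m g'.
  elim: N v => [|N IHN] v bv vg0.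
    exists 0; first by move=> p; rewrite mxE eqxx.
    rewrite mul0mx; apply/rowP => p; rewrite mxE.
    by apply/eqP/negPn/negP => /bv.
  case: (pickP (fun q => key q == N)) => [q /eqP key_q|nokey]; last first.
    have [|w bw def_w] := IHN v _ vg0; last first.
      by exists w => //; apply: below_trans bw; rewrite leq_mul2r leqnSn orbT.
    by move=> p /bv; rewrite ltnS leq_eqVlt nokey.
  have [|h def_vq] := (var_idealP (V q) (v 0 q)).1.
    apply/lq_colon; exists (v 0 q *: delta_mx 0 q - v); last first.
      by rewrite mulmxBl vg0 subr0 -scalemxAl -rowE.
    move=> p; rewrite !mxE eqxx /=; have [->|neq_pq] := eqVneq p q.
      by rewrite mulr1 subrr eqxx.
    rewrite mulr0 sub0r oppr_eq0 => /bv; rewrite key_q ltnS leq_eqVlt.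
    by case/orP => // /eqP; rewrite -key_q => /lq_key_inj /eqP; rewrite (negPf neq_pq).
  pose u := \sum_(k in V q) h k *: z (q, k).
  have uE p : u 0 p = \sum_(k in V q) h k * z (q, k) 0 p.
    by rewrite summxE; apply: eq_bigr => k _; rewrite mxE.
  have [||w bw def_w] := IHN (v - u).
  - move=> p; apply: contraNT; rewrite -leqNgt leq_eqVlt -key_q => /orP[/eqP|lt_qp].
      move/lq_key_inj <-; rewrite !mxE uE subr_eq0 {1}def_vq; apply/eqP.
      by apply: eq_bigr => k Vk; rewrite zdiag.
    rewrite !mxE uE big1 ?subr0 => [|k Vk]; last by rewrite zhigh ?mulr0.
    by apply/negPn/negP => /bv; rewrite -key_q ltnS leqNgt lt_qp.
  - rewrite mulmxBl vg0 sub0r mulmx_suml big1 ?oppr0 // => k Vk.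
    by rewrite -scalemxAl zg // scaler0.
  exists (w + \row_a (if (idx a).1 == q then h (idx a).2 else 0)).
    apply: belowD; first by apply: below_trans bw; rewrite leq_mul2r leqnSn orbT.
    move=> a; rewrite mxE; case: (_ =P q) => [def_q _|_]; last by rewrite eqxx.
    by rewrite /key' def_q key_q mulSn addnC ltn_add2r.
  by rewrite mulmxDl slice -def_w subrK.
have hom' : mx_homog (fun a => deg (idx a).1 + U_((idx a).2))%MM deg g'.
  move=> a p; rewrite mxE; have [_ hom _ _] := zP _ (idxA a).
  exact: hom.
(* Division by n recovers the two digits of key'. *)
have key'_inj : injective key'.
  move=> a b eq_ab; apply: enum_val_inj; rewrite -/(idx a) -/(idx b).
  move: eq_ab; rewrite /key'; case: (idx a) (idx b) => [q k] [q' k'] /= eq_ab.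
  have n_gt0 : (0 < n)%N by apply: leq_ltn_trans (ltn_ord k).
  have := congr1 (divn^~ n) eq_ab.
  rewrite !divnMDl // !divn_small ?addn0 // => /lq_key_inj eq_q.
  by move: eq_ab; rewrite eq_q => /addnI /val_inj ->.
have colon' a f :
    (exists2 c, below key' (key' a) c & f *: row a g' = c *m g') <->
    var_ideal (V' a) f.
  (* Comparing coordinates q, where q is the generator that a lies over. *)
  split=> [[c bc /rowP/(_ (idx a).1)]|].
    rewrite !mxE; case: (zP _ (idxA a)) => _ _ -> _ def_f.
    apply: (@var_ideal_colon _ _ _ (idx a).2); first by rewrite inE ltnn andbF.
    rewrite def_f; apply: (big_ind (var_ideal _)); first exact: var_ideal0.
      exact: var_idealD.
    move=> b _; rewrite !mxE; have [->|/bc] := eqVneq (c 0 b) 0.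
      by rewrite mul0r; apply: var_ideal0.
    have := idxA b; rewrite /V' /key'.
    case: (idx a) (idx b) => [q k] [q' k'] /= Vk' lt_ba.
    have n_gt0 : (0 < n)%N by apply: leq_ltn_trans (ltn_ord k).
    have := leq_div2r n (ltnW lt_ba).
    rewrite !divnMDl // !divn_small ?addn0 // leq_eqVlt => /orP[/eqP eq_q|lt_q].
      move: lt_ba; rewrite eq_q ltn_add2l -(lq_key_inj eq_q) zdiag // => lt_k.
      by apply: var_ideal_mulX; rewrite inE Vk'.
    by rewrite zhigh // mulr0; apply: var_ideal0.
  (* Conversely, if f = sum of the h_k' x_k' with k' < k, subtracting from
     f z_(q,k) the h_k' x_k z_(q,k') cancels the coordinate q. *)
  case/var_idealP => h def_f; move def_a: (idx a) (idxA a) => [q k] /= Vk.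
  pose h' (k' : 'I_n) : S := if (k' < k)%N then h k' * 'X_k else 0.
  have V'E (T : zmodType) (F : 'I_n -> T) :
      \sum_(k' in V' a) F k' = \sum_(k' in V q) if (k' < k)%N then F k' else 0.
    rewrite -big_mkcondr; apply: eq_bigl => k'.
    by rewrite inE def_a.
  have [||w bw def_w] :=
      lift (key q) (f *: z (q, k) - \sum_(k' in V q) h' k' *: z (q, k')).
  - move=> p; apply: contraNT; rewrite -leqNgt leq_eqVlt => /orP[/eqP|lt_qp].
      move/lq_key_inj <-; rewrite !mxE summxE zdiag // def_f V'E.
      rewrite mulr_suml subr_eq0; apply/eqP/eq_bigr => k' Vk'.
      by rewrite mxE zdiag // /h'; case: ifP; rewrite ?mul0r // mulrAC.
    rewrite !mxE summxE zhigh // mulr0 sub0r oppr_eq0 big1 // => k' Vk'.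
    by rewrite mxE zhigh // mulr0.
  - rewrite mulmxBl -scalemxAl zg // scaler0 sub0r mulmx_suml big1 ?oppr0 // => k' Vk'.
    by rewrite -scalemxAl zg // scaler0.
  exists (w + \row_b (if (idx b).1 == q then h' (idx b).2 else 0)); last first.
    by rewrite mulmxDl slice -def_w subrK rowK def_a.
  apply: belowD; first by apply: below_trans bw; rewrite /key' def_a leq_addr.
  move=> b; rewrite mxE; case: (_ =P q) => [def_q|_]; last by rewrite eqxx.
  rewrite /h' /key' def_a def_q ltn_add2l /=.
  by case: ifP; rewrite ?eqxx.
pose t := LqSystem hom' key'_inj colon'.
exists t; split=> [v|a]; last by exists (idx a).1, (idx a).2.
split=> [vg0|[w ->]].
  have [|w _ ->] := lift (\max_p key p).+1 v _ vg0; last by exists w.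
  by move=> p _; rewrite ltnS leq_bigmax.
rewrite -mulmxA (_ : g' *m g = 0) ?mulmx0 //; apply/row_matrixP => a.
by rewrite row_mul rowK row0; have [] := zP _ (idxA a).
Qed.

End Syzygies.

End LinearQuotients.

(** * The resolution of an ideal with linear quotients *)

Section LinearQuotientResolution.
Variables (K : fieldType) (n : nat).
Local Notation S := {mpoly K[n]}.

Definition next_syzygies r (be : 'I_r -> 'X_{1..n}) (s : lq_system K be) :
    lq_system K (@lq_deg _ _ _ _ s) :=
  proj1_sig (constructive_indefinite_description _ (lq_syzygies s)).

Lemma next_syzygiesP r (be : 'I_r -> 'X_{1..n}) (s : lq_system K be) :
  (forall v : 'rV_(lq_rank s), v *m lq_gen s = 0 <->
     exists w, v = w *m lq_gen (next_syzygies s)) /\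
  (forall p, exists q k,
     lq_deg (l := next_syzygies s) p = (lq_deg (l := s) q + U_(k))%MM).
Proof. by rewrite /next_syzygies; case: constructive_indefinite_description. Qed.

Variables (N : (S^o)%type -> Prop) (s : lq_system K (fun _ : 'I_1 => 0%MM : 'X_{1..n})).

(** The ambient free module of each level is the one whose basis indexes the
    generators of the preceding level; carrying it in the pair makes the
    dimensions of consecutive differentials match by computation. *)
Fixpoint syzygy_tower i : {r : nat & {be : 'I_r -> 'X_{1..n} & lq_system K be}} :=
  if i is j.+1 then
    let t := projT2 (projT2 (syzygy_tower j)) in
    existT _ (lq_rank t) (existT _ (@lq_deg _ _ _ _ t) (next_syzygies t))
  else existT _ 1%N (existT _ (fun=> 0%MM) s).

Definition syzygy_level i := projT2 (projT2 (syzygy_tower i)).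

(** Level i + 1 of the tower consists of the syzygies of level i, so that the
    generators of the levels are the differentials of an exact complex. *)
Lemma lq_resolution :
  (forall x : S^o, N x <->
     exists v : 'rV_(lq_rank s), x = \sum_q v 0 q *: (lq_gen s q 0 : S^o)) ->
  exists F : graded_free_resolution (sgrading K n) N,
    [/\ frrank F 0 = lq_rank s,
        forall q : 'I_(frrank F 0), exists p,
          frshift q = lq_deg (l := s) p /\ fraug q = lq_gen s p 0 &
        forall i (p : 'I_(frrank F i.+1)), exists (q : 'I_(frrank F i)) k,
          frshift p = (frshift q + U_(k))%MM].
Proof.
move=> genN.
have exact0 (v : 'rV_(lq_rank s)) :
    \sum_q v 0 q *: (lq_gen s q 0 : S^o) = 0 <->
    exists w, v = w *m lq_gen (syzygy_level 1).
  rewrite -(next_syzygiesP s).1; split=> [v0|/matrixP/(_ 0 0)]; last by rewrite !mxE.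
  by apply/matrixP => i j; rewrite !ord1 !mxE.
have homog0 q : scomp (@lq_deg _ _ _ _ s q) (lq_gen s q 0).
  by have := @lq_homog _ _ _ _ s q 0; rewrite mpolyX0 mulr1.
pose F := @GradedFreeResolution K n S^o (sgrading K n) N
  (fun i => lq_rank (syzygy_level i))
  (fun i => @lq_deg _ _ _ _ (syzygy_level i))
  (fun i => lq_gen (syzygy_level i.+1))
  (fun q => lq_gen s q 0)
  (fun i => @lq_homog _ _ _ _ (syzygy_level i.+1))
  homog0 genN exact0
  (fun i => (next_syzygiesP (syzygy_level i.+1)).1).
exists F; split=> // [q|i p]; first by exists q.
exact: (next_syzygiesP (syzygy_level i)).2.
Qed.

End LinearQuotientResolution.

(** * Monomial ideals with linear quotients *)

Section MonomialLinearQuotients.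
Variables (K : fieldType) (n : nat).
Local Notation S := {mpoly K[n]}.

(** For monomials, the colon condition of a system of linear quotients can be
    checked on monomial multipliers. *)
Lemma monomial_lq_system m (t : 'I_m -> 'X_{1..n}) (key : 'I_m -> nat)
    (V : 'I_m -> {set 'I_n}) :
  injective key ->
  (forall q a, (exists2 p, (key p < key q)%N & (t p <= a + t q)%MM) <->
               (exists2 k, k \in V q & a k != 0%N)) ->
  exists s : lq_system K (fun _ : 'I_1 => 0%MM : 'X_{1..n}),
    exists eq_m : lq_rank s = m,
      forall q, lq_deg (l := s) q = t (cast_ord eq_m q) /\
                lq_gen s q 0 = 'X_[t (cast_ord eq_m q)].
Proof.
move=> key_inj colon; pose g : 'M[S]_(m, 1) := \matrix_(q, _) 'X_[t q].
have homg : mx_homog t (fun=> 0%MM) g.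
  by move=> p q; rewrite mxE mpolyX0 mulr1; exists 1; rewrite scale1r.
have colong q f :
    (exists2 c, below key (key q) c & f *: row q g = c *m g) <-> var_ideal (V q) f.
  split=> [[c bc /matrixP/(_ 0 0)] | /var_idealP[h ->]].
    rewrite !mxE => def_f a fa; apply/colon.
    have [p /andP[cp t_p]|none] := pickP (fun p =>
        (c 0 p != 0) && (t p <= a + t q)%MM); first by exists p; rewrite ?bc.
    case/negP: fa; rewrite -(mcoeffMX f (t q)) def_f raddf_sum big1 //= => p _.
    rewrite mxE; apply/eqP; rewrite mcoeff_eq0 (perm_mem (msuppMX _ _)).
    apply/mapP => -[b cb def_a]; have := none p; rewrite addmC def_a lem_addr andbT.
    by move/negbFE/eqP => c0; rewrite c0 msupp0 in cb.
  apply: (big_ind (fun f => exists2 c, _ & f *: row q g = c *m g)).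
  - by exists 0; rewrite ?scale0r ?mul0mx // => p; rewrite mxE eqxx.
  - move=> f1 f2 [c1 bc1 def1] [c2 bc2 def2]; exists (c1 + c2).
      exact: belowD.
    by rewrite scalerDl mulmxDl def1 def2.
  move=> k Vk; have [|p lt_pq dvd_p] := (colon q U_(k)%MM).2.
    by exists k; rewrite // mnm1E eqxx.
  exists (h k * 'X_[U_(k) + t q - t p] *: delta_mx 0 p).
    move=> p'; rewrite !mxE eqxx; case: (p' =P p) => [-> //|_].
    by rewrite mulr0 eqxx.
  rewrite -scalemxAl -rowE; apply/matrixP => i j; rewrite !mxE -!mulrA.
  by rewrite -!mpolyXD submK.
exists (LqSystem homg key_inj colong), erefl => q /=.
by rewrite mxE cast_ord_id.
Qed.

Variable N : (S^o)%type -> Prop.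

(** Choose a generator x^b of least total degree.  If it became a boundary
    modulo the variables, there would be a relation between the generators with
    constant coefficient 1 at x^b and 0 elsewhere; the other generators, having
    at least the same degree, cannot contribute to its term of degree b. *)
Lemma tor_dim0_neq0 (F : graded_free_resolution (sgrading K n) N) :
  (0 < frrank F 0)%N ->
  (forall q : 'I_(frrank F 0), fraug q = 'X_[frshift q]) ->
  exists q : 'I_(frrank F 0), tor_dim F 0 (frshift q) != 0%N.
Proof.
move=> rk_gt0 monF; pose sh := @frshift K n _ _ N F 0.
pose q := [arg min_(p < Ordinal rk_gt0) mdeg (sh p)].
have min_q p : (mdeg (sh q) <= mdeg (sh p))%N.
  by rewrite /q; case: arg_minnP => // p' _; apply.
exists q; apply/eqP => tor0.
set Z := (tor_degree F 0 (sh q) :&: tor_cycles F 0)%MS.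
have subZ : (Z <= tor_diff F 0)%MS.
  have: (Z <= Z :&: tor_diff F 0)%MS; last by rewrite sub_capmx => /andP[].
  rewrite -(mxrank_leqif_sup (capmxSl _ _)).2 -[eqbRHS](mxrank_cap_compl Z (tor_diff F 0)).
  by rewrite -[X in X == _]addn0 eqn_add2l eq_sym; apply/eqP.
have /submxP[w def_w] : ((delta_mx 0 q : 'rV_(frrank F 0)) <= tor_diff F 0)%MS.
  apply: submx_trans subZ; rewrite sub_capmx submx1 andbT.
  apply/submxP; exists (delta_mx 0 q); apply/rowP => p.
  by rewrite -rowE !mxE !eqxx /= eq_sym; case: (q == p).
pose v := map_mx (@mpolyC n K) w *m frdiff F 0.
have v0 p : (v 0 p)@_0 = (p == q)%:R.
  have /rowP/(_ p) := def_w; rewrite !mxE eqxx /= => ->.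
  rewrite raddf_sum; apply: eq_bigr => j _.
  by rewrite !mxE; apply: mcoeffCM.
have := (fr_exact0 v).2 (ex_intro _ _ erefl).
move/(congr1 (mcoeff (sh q))); rewrite mcoeff0 raddf_sum /= => /eqP.
rewrite (bigD1 q) //= big1 => [|p neq_pq].
  rewrite addr0 monF -[sh q]addm0 -[_ *: _]/(_ * _) mcoeffMX v0 eqxx.
  by rewrite oner_eq0.
rewrite monF -[_ *: _]/(_ * _); apply/eqP; rewrite mcoeff_eq0.
apply: contra neq_pq; rewrite (perm_mem (msuppMX _ _)) => /mapP[a va def_a].
have a0 : a = 0%MM.
  apply/eqP; rewrite -mdeg_eq0 -leqn0 -(leq_add2l (mdeg (sh p))) -mdegD addn0.
  by rewrite /sh -def_a min_q.
rewrite a0 mcoeff_msupp v0 in va.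
by case: (p == q) va => //; rewrite eqxx.
Qed.

End MonomialLinearQuotients.

(** * Support-linearity of the components *)

Section MonomialSpan.
Variables (K : fieldType) (n : nat).
Local Notation S := {mpoly K[n]}.

Lemma mono_ideal_msupp (A : 'X_{1..n} -> Prop) (f : S) a :
  mono_ideal A f -> f@_a != 0 -> exists2 b, A b & (b <= a)%MM.
Proof.
case=> r [c [g [Ag ->]]] fa.
have [j cg_a|none] := pickP (fun j => (c j *: g j : S)@_a != 0); last first.
  by case/eqP: fa; rewrite raddf_sum big1 // => j _; apply/eqP/negbFE/none.
have [b Ab def_g] := Ag j; exists b => //; move: cg_a; rewrite def_g.
rewrite -[_ *: _]/(_ * _) -mcoeff_msupp (perm_mem (msuppMX _ _)).
by case/mapP=> a' _ ->; apply: lem_addr.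
Qed.

Lemma mono_idealX (A : 'X_{1..n} -> Prop) a :
  mono_ideal A ('X_[a] : S) <-> exists2 b, A b & (b <= a)%MM.
Proof.
split=> [/mono_ideal_msupp|[b Ab le_ba]].
  by apply; rewrite mcoeffX eqxx oner_eq0.
exists 1%N, (fun=> 'X_[a - b]), (fun=> 'X_[b]); split; first by exists b.
by rewrite big_ord1 -[_ *: _]/(_ * _) -mpolyXD submK.
Qed.

Lemma colon_by_variablesP (s : seq 'X_{1..n}) u :
  colon_by_variables K s u -> exists V : {set 'I_n}, forall a,
    (exists2 b, b \in s & (b <= a + u)%MM) <-> (exists2 k, k \in V & a k != 0%N).
Proof.
case=> V colonV; exists V => a; rewrite -mono_idealX mpolyXD colonV mono_idealX.
split=> [[_ [k Vk ->] le_ka]|[k Vk ak]].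
  by exists k; rewrite // -mnm_le_suppU.
by exists U_(k)%MM; [exists k | rewrite mnm_le_suppU].
Qed.

Definition mono_span m (t : 'I_m -> 'X_{1..n}) (x : S^o) : Prop :=
  exists v : 'rV[S]_m, x = \sum_q v 0 q *: ('X_[t q] : S^o).

Section Span.
Variables (m : nat) (t : 'I_m -> 'X_{1..n}).

Lemma mono_spanZ c x : mono_span t x -> mono_span t (c *: x).
Proof.
move=> [v ->]; exists (c *: v); rewrite scaler_sumr; apply: eq_bigr => q _.
by rewrite mxE scalerA.
Qed.

Lemma mono_span_gen (G : S^o -> Prop) x :
  (forall y, G y -> mono_span t y) -> submod_gen G x -> mono_span t x.
Proof.
move=> Gt [r [c [g [Gg ->]]]]; apply: (big_ind (mono_span t)).
- by exists 0; rewrite big1 // => q _; rewrite mxE scale0r.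
- move=> _ _ [v ->] [w ->]; exists (v + w); rewrite -big_split.
  by apply: eq_bigr => q _; rewrite mxE scalerDl.
by move=> j _; apply/mono_spanZ/Gt.
Qed.

Lemma mono_spanX q : mono_span t 'X_[t q].
Proof.
exists (delta_mx 0 q); rewrite (bigD1 q) //= mxE !eqxx scale1r big1 ?addr0 // => p.
by rewrite mxE => /negPf->; rewrite andbF scale0r.
Qed.

Lemma mono_spanZX (c : K) q a :
  (t q <= a)%MM -> mono_span t (c *: 'X_[a] : S).
Proof.
move=> dvd_q.
suff -> : c *: 'X_[a] = (c *: 'X_[a - t q] : S) *: ('X_[t q] : S^o).
  exact/mono_spanZ/mono_spanX.
by rewrite -[RHS]/(_ * _) -scalerAl -mpolyXD submK.
Qed.

Lemma suppdeg_part_span (I : S^o -> Prop) d x :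
  (forall q, I 'X_[t q]) -> (forall q, suppdeg (t q) = d) ->
  mono_span t x -> suppdeg_part (sgrading K n) I d x.
Proof.
move=> It deg_t [v ->]; exists m, (v 0), (fun q => 'X_[t q]); split=> // q.
by split; [apply: It | exists (t q); [exists 1; rewrite scale1r | apply: deg_t]].
Qed.

End Span.

(** The ideal is resolved by iterating [lq_syzygies], which raises the
    support-degree by at most one at each step.  With [tor_dim_eq0] this bounds
    the support-regularity by d, and with [tor_dim0_neq0] the bound is reached
    in homological degree 0. *)
Lemma monomial_lq_support_linear (N : S^o -> Prop) d m
    (t : 'I_m -> 'X_{1..n}) (key : 'I_m -> nat) (V : 'I_m -> {set 'I_n}) :
  (forall x, N x <-> mono_span t x) ->
  injective key ->
  (forall q a, (exists2 p, (key p < key q)%N & (t p <= a + t q)%MM) <->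
               (exists2 k, k \in V q & a k != 0%N)) ->
  (forall q, suppdeg (t q) = d) ->
  support_linear (sgrading K n) d N.
Proof.
move=> genN key_inj colon deg_t.
have [m0|m_gt0] := posnP m.
  left=> x; rewrite genN; split=> [[v ->]|->].
    by rewrite big1 // => q; have := leq_trans (ltn_ord q) (eq_leq m0).
  by exists 0; rewrite big1 // => q _; rewrite mxE scale0r.
right; split=> [x|].
  split=> [/genN|Nx].
    by apply: suppdeg_part_span => // q; apply/genN/mono_spanX.
  by apply/genN; apply: mono_span_gen Nx => y [/genN].
have [s [eq_m sP]] := monomial_lq_system K key_inj colon.
have [|F [rkF gensF degF]] := @lq_resolution K n N s.
  move=> x; rewrite genN; subst m; split=> -[v ->]; exists v; apply: eq_bigr => q _;
  by rewrite (sP q).2 cast_ord_id.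
have monF (q : 'I_(frrank F 0)) : fraug q = 'X_[frshift q].
  by have [p [-> ->]] := gensF q; rewrite (sP p).2 (sP p).1.
have sdF i (q : 'I_(frrank F i)) : (suppdeg (frshift q) <= d + i)%N.
  elim: i q => [|i IHi] q.
    by have [p [-> _]] := gensF q; rewrite (sP p).1 deg_t addn0.
  have [q' [k ->]] := degF i q; apply: leq_trans (suppdegDU _ _) _.
  by rewrite addnS ltnS.
split.
  have [|q tor_q] := tor_dim0_neq0 _ monF; first by rewrite rkF eq_m.
  exists 0%N, (frshift q), (tor_dim F 0 (frshift q)); split; first by exists F.
    exact/eqP.
  by have [p [-> _]] := gensF q; rewrite (sP p).1 deg_t subr0.
move=> i b k [F' <-] tor_b; rewrite lerBlDr lez_nat.
have [q /eqP <-|none] := pickP (fun q : 'I_(frrank F i) => frshift q == b).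
  exact: sdF.
by case: tor_b; apply: (@tor_dim_eq0 _ _ _ _ F) => q; rewrite none.
Qed.

(** The first colon ideal, by the empty list, is generated by no variable. *)
Lemma admissible_order_colons (I : S^o -> Prop) (s : seq 'X_{1..n}) :
  admissible_order I s ->
  exists V : 'I_(size s) -> {set 'I_n}, forall (j : 'I_(size s)) a,
    (exists2 i : 'I_(size s), (i < j)%N & (nth 0%MM s i <= a + nth 0%MM s j)%MM) <->
    (exists2 k, k \in V j & a k != 0%N).
Proof.
case=> _ _ colon_s.
apply: (@fin_all_exists _ _ (fun (j : 'I_(size s)) (V : {set 'I_n}) => forall a,
  (exists2 i : 'I_(size s), (i < j)%N & (nth 0%MM s i <= a + nth 0%MM s j)%MM) <->
  (exists2 k, k \in V & a k != 0%N))) => j.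
have [j0|j_gt0] := posnP j.
  by exists set0 => a; split=> -[k]; rewrite ?j0 ?inE.
have [|V colonV] := colon_by_variablesP (colon_s j _); first by rewrite j_gt0 /=.
exists V => a; rewrite -colonV; split=> [[i lt_ij dvd_i]|[b]].
  exists (nth 0%MM s i) => //; rewrite -(nth_take _ lt_ij) mem_nth //.
  by rewrite size_takel // ltnW.
case/(nthP 0%MM) => i; rewrite size_takel ?(ltnW (ltn_ord j)) // => lt_ij.
by rewrite nth_take // => <-; exists (Ordinal (ltn_trans lt_ij (ltn_ord j))).
Qed.

End MonomialSpan.

Theorem theorem3p8 (K : fieldType) (n : nat) (I : ({mpoly K[n]}^o)%type -> Prop) :
  is_monomial_ideal I ->
  (exists s : seq 'X_{1..n}, admissible_order I s /\ suppdeg_increasing s) ->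
  componentwise_support_linear (sgrading K n) I.
Proof.
move=> _ [s [adm_s incr_s]] d _.
have [V colonV] := admissible_order_colons adm_s; have [_ [genI _] _] := adm_s.
pose u (j : 'I_(size s)) := nth 0%MM s j.
have incr_u (i j : 'I_(size s)) : (i <= j)%N -> (suppdeg (u i) <= suppdeg (u j))%N.
  move=> le_ij; have := sorted_leq_nth leq_trans leqnn 0%N incr_s i j.
  rewrite !inE size_map => /(_ (ltn_ord i) (ltn_ord j) le_ij).
  by rewrite !(nth_map 0%MM).
pose t (q : 'I_#|comp_index u V d|) := comp_gen u (enum_val q).
have deg_t q : suppdeg (t q) = d by apply: (suppdeg_comp_gen (enum_valP q)).
apply: (@monomial_lq_support_linear _ _ _ _ _ t (fun q => comp_key (enum_val q))
  (fun q => comp_var u V (enum_val q))) => // [x|q p|q a]; last 1 first.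
- rewrite -(comp_gen_colon colonV incr_u _ (enum_valP q)).
  split=> [[p lt_pq dvd_p]|[y [Ty lt_yq dvd_y]]].
    by exists (enum_val p); split=> //; apply: enum_valP.
  by exists (enum_rank_in Ty y); rewrite /t ?enum_rankK_in.
- split; last first.
    apply: suppdeg_part_span => // q; apply/genI/mono_idealX.
    exists (u (enum_val q).1); first exact: mem_nth.
    exact: lem_addr.
  apply: mono_span_gen => y [Iy [a [c def_y] deg_a]]; rewrite def_y in Iy *.
  have [->|c_neq0] := eqVneq c 0.
    by exists 0; rewrite scale0r big1 // => q _; rewrite mxE scale0r.
  have [_ /(nthP 0%MM)[i lt_i <-] dvd_i] : exists2 b, b \in s & (b <= a)%MM.
    apply: (mono_ideal_msupp ((genI _).1 Iy)).
    by rewrite mcoeffZ mcoeffX eqxx mulr1.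
  have [||z [Tz _ dvd_z]] :=
    @comp_gen_cover _ _ _ _ colonV incr_u d (Ordinal lt_i) _ dvd_i.
  - by rewrite -deg_a suppdeg_le.
  - by rewrite deg_a.
  by apply: (@mono_spanZX _ _ _ t c (enum_rank_in Tz z)); rewrite /t enum_rankK_in.
by move/comp_key_inj/enum_val_inj.
Qed.
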